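(* Let $g\ge 1$, let $\mathrm{al}_1,\mathrm{al}_2,\mathrm{al}_{12}$ be the hyperelliptic al functions of the genus $g$ curve $X:\ y^2=\prod_{i=1}^{2g+1}(x-b_i)$ described in the context, and write $h':=\partial_{u_g}h$. Put $\phi^{[a]}:=\log\mathrm{al}_a$ $(a=1,2)$ and $$\mathfrak a^\circ_{12}:=\frac{b_2-b_1}{\phi^{[2]\prime}-\phi^{[1]\prime}},\qquad \mathfrak D^\circ_{12}:=\frac{(b_2-b_1)(\phi^{[2]\prime}+\phi^{[1]\prime})}{\phi^{[2]\prime}-\phi^{[1]\prime}} .$$ Then the following identities hold (wherever the denominators do not vanish): (1) $\displaystyle \partial_{u_g}^2\mathrm{al}_{12}=\bigl(\partial_{u_g}\phi^{[2]}+\partial_{u_g}\phi^{[1]}\bigr)\,\mathrm{al}_1\mathrm{al}_2$, i.e. $\displaystyle \partial_{u_g}^2\mathrm{al}_{12}=(b_2-b_1)\left[\frac{\phi^{[2]\prime}+\phi^{[1]\prime}}{\phi^{[2]\prime}-\phi^{[1]\prime}}\right]\mathrm{al}_{12}$, i.e. $\partial_{u_g}^2\mathrm{al}_{12}=\mathfrak D^\circ_{12}\,\mathrm{al}_{12}$; (2) $\displaystyle \partial_{u_g}^2\frac{\mathrm{al}_2}{\mathrm{al}_1}-\Bigl[2\phi^{[1]\prime}\bigl(\phi^{[1]\prime}-\phi^{[2]\prime}\bigr)+(b_2-b_1)\Bigr]\frac{\mathrm{al}_2}{\mathrm{al}_1}=0$; (3) $\displaystyle \partial_{u_g}^2\frac{1}{\mathrm{al}_{12}}+\Bigl[\mathfrak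 D^\circ_{12}-2(\mathfrak a^\circ_{12})^2\Bigr]\frac{1}{\mathrm{al}_{12}}=0$.
   Context: Curve: $b_1,\dots,b_{2g+1}\in\mathbb C$ are pairwise distinct, $f(x):=\prod_{i=1}^{2g+1}(x-b_i)=x^{2g+1}+\lambda_{2g}x^{2g}+\cdots+\lambda_0$, and $X$ is the genus $g$ hyperelliptic curve $y^2=f(x)$ completed by one smooth point $\infty$ at infinity. Coordinates: for $((x_i,y_i))_{i=1,\dots,g}\in S^gX$ put $u=(u_1,\dots,u_g)\in\mathbb C^g$, $u_j=\sum_{i=1}^g\int_\infty^{(x_i,y_i)}\frac{x^{j-1}dx}{2y}$. All functions are regarded as functions of $u$ on an open set of $\mathbb C^g$ on which the $(x_i,y_i)$ are (finite) holomorphic functions of $u$, the $x_i$ are pairwise distinct, and no $x_i$ equals $b_1$ or $b_2$. With $F(x):=\prod_{i=1}^g(x-x_i)$, $F'=dF/dx$, and $F(x)/(x-x_i)=\sum_{k=0}^{g-1}\chi_{i,k}x^k$, the partial derivatives are $$\frac{\partial x_i}{\partial u_r}=\frac{2y_i\,\chi_{i,r-1}}{F'(x_i)},\qquad \frac{\partial y_i}{\partial u_r}=\frac{f'(x_i)\,\chi_{i,r-1}}{F'(x_i)}\qquad(1\le r\le g).$$ In particular $\chi_{i,g-1}=1$. Al functions: for $a=1,2$, $\mathrm{al}_a$ is a holomorphic branch of the square root $\mathrm{al}_a(u)=\sqrt{\prod_{i=1}^g(x_i-b_a)}$, i.e. $\mathrm{al}_a^2=(-1)^gF(b_a)$, and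 $$\mathrm{al}_{12}(u)=\mathrm{al}_1(u)\,\mathrm{al}_2(u)\sum_{r=1}^g\frac{y_r}{(b_1-x_r)(b_2-x_r)F'(x_r)} .$$ The derivative $\phi^{[a]\prime}=\partial_{u_g}\mathrm{al}_a/\mathrm{al}_a$ does not depend on the branch of the logarithm or square root. *)

(* Defs.v *)
From HB Require Import structures.
From mathcomp Require Import all_boot all_order all_algebra.
From mathcomp Require Import complex.
From mathcomp Require Import all_classical all_reals all_analysis.
Import Order.TTheory GRing.Theory Num.Theory.
Import numFieldNormedType.Exports.

Set Implicit Arguments.
Unset Strict Implicit.
Unset Printing Implicit Defensive.

Local Open Scope classical_set_scope.
Local Open Scope ring_scope.

(* R[i] carries no canonical topology.  Naming it as a numFieldType gives it
   the norm topology, and makes differentiability and directional derivatives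
   of functions on 'rV[Cplx R]_g the C-linear ones. *)
Definition Cplx (R : realType) : numFieldType := (R[i])%C.

Section ComplexValuedFunctionsOfARealVariable.
Context {R : realType}.
Implicit Types (h : R -> Cplx R).

Definition Cmk (a b : R) : Cplx R := (a +i* b)%C.
Definition CRe (z : Cplx R) : R := complex.Re (z : R[i]%C).
Definition CIm (z : Cplx R) : R := complex.Im (z : R[i]%C).
Definition Cmod (z : Cplx R) : R := ComplexField.Normc.normc (z : R[i]%C).

Definition C1_on01 (k : R -> R) : Prop :=
  forall t : R, 0 < t < 1 -> derivable k t 1 /\ {for t, continuous (derive1 k)}.

Definition velocity h (t : R) : Cplx R :=
  Cmk (derive1 (CRe \o h) t) (derive1 (CIm \o h) t).

Definition integrable01 h : Prop :=
  (@lebesgue_measure R).-integrable `]0, 1[ (EFin \o (CRe \o h)) /\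
  (@lebesgue_measure R).-integrable `]0, 1[ (EFin \o (CIm \o h)).

Definition integral01 h : Cplx R :=
  Cmk (\int[@lebesgue_measure R]_(t in `]0, 1[) CRe (h t))
      (\int[@lebesgue_measure R]_(t in `]0, 1[) CIm (h t)).

End ComplexValuedFunctionsOfARealVariable.

Section HyperellipticCurve.
Context {R : realType} {g : nat}.
Local Notation C := (Cplx R).
Implicit Types (b : 'I_(2 * g).+1 -> C).

Definition fpoly b : {poly C} := \prod_(i < (2 * g).+1) ('X - (b i)%:P).

Definition on_curve b (p q : C) : Prop := q ^+ 2 = (fpoly b).[p].

(* A C^1 path (gx, gy) on the curve, parametrised by ]0,1[, from the point at
   infinity to the finite point (p, q).  It avoids infinity and the branch
   points y = 0 except possibly at its ends: every homotopy class contains such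
   a path, and x^j dx / 2y then pulls back to [abel_form] without division
   by 0. *)
Record path_from_infinity b (gx gy : R -> C) (p q : C) : Prop := {
  path_on_curve : forall t : R, 0 < t < 1 -> on_curve b (gx t) (gy t);
  path_unbranched : forall t : R, 0 < t < 1 -> gy t != 0;
  path_C1 : [/\ C1_on01 (CRe \o gx), C1_on01 (CIm \o gx),
                C1_on01 (CRe \o gy) & C1_on01 (CIm \o gy)];
  path_start : Cmod (gx t) @[t --> 0^'+] --> +oo;
  path_end_x : gx t @[t --> 1^'-] --> p;
  path_end_y : gy t @[t --> 1^'-] --> q
}.

Definition abel_form (gx gy : R -> C) (j : nat) (t : R) : C :=
  gx t ^+ j * velocity gx t / (2 * gy t).

(* u is one of the values of the multivalued Abel map at ((p i, q i))_i: for
   each i a single path serves all the differentials.  Indices are 0-based, so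
   the coordinate j goes with x^j dx / 2y. *)
Definition abel_value b (p q : 'I_g -> C) (u : 'rV[C]_g) : Prop :=
  exists gx gy : 'I_g -> R -> C,
    (forall i, path_from_infinity b (gx i) (gy i) (p i) (q i)) /\
    forall j : 'I_g,
      (forall i, integrable01 (abel_form (gx i) (gy i) j)) /\
      u 0 j = \sum_(i < g) integral01 (abel_form (gx i) (gy i) j).

Definition Fpoly (p : 'I_g -> C) : {poly C} := \prod_(i < g) ('X - (p i)%:P).

Definition chi (p : 'I_g -> C) (i : 'I_g) (k : nat) : C :=
  (Fpoly p %/ ('X - (p i)%:P))`_k.

Definition partial (r : 'I_g) (h : 'rV[C]_g -> C) (u : 'rV[C]_g) : C :=
  'D_(delta_mx 0 r) h u.

(* The row vector is the last basis vector (when 0 < g). *)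
Definition partial_last (h : 'rV[C]_g -> C) (u : 'rV[C]_g) : C :=
  'D_(\row_(j < g) (j.+1 == g)%:R) h u.

Definition holomorphic_on (U : set 'rV[C]_g) (h : 'rV[C]_g -> C) : Prop :=
  forall u, U u -> differentiable h u.

Definition al_branch (U : set 'rV[C]_g) (x : 'I_g -> 'rV[C]_g -> C) (c : C)
    (al : 'rV[C]_g -> C) : Prop :=
  holomorphic_on U al /\
  forall u, U u -> al u ^+ 2 = \prod_(i < g) (x i u - c).

Definition al_pair (x y : 'I_g -> 'rV[C]_g -> C) (b1 b2 : C)
    (al1 al2 : 'rV[C]_g -> C) (u : 'rV[C]_g) : C :=
  al1 u * al2 u *
  \sum_(r < g) y r u / ((b1 - x r u) * (b2 - x r u) *
                        (Fpoly (fun i => x i u))^`().[x r u]).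

(* Derivative of log al along the last coordinate; log itself is only defined
   up to the choice of a branch. *)
Definition dlog (al : 'rV[C]_g -> C) (u : 'rV[C]_g) : C :=
  partial_last al u / al u.

Definition a_circ (b1 b2 : C) (al1 al2 : 'rV[C]_g -> C) (u : 'rV[C]_g) : C :=
  (b2 - b1) / (dlog al2 u - dlog al1 u).

Definition D_circ (b1 b2 : C) (al1 al2 : 'rV[C]_g -> C) (u : 'rV[C]_g) : C :=
  (b2 - b1) * (dlog al2 u + dlog al1 u) / (dlog al2 u - dlog al1 u).

End HyperellipticCurve.

(* Main.v *)
(* Put F = prod_i (X - x_i) and F_X = dF/dX, let ' be the derivative along
   u_g, and let P_a = al_a' / al_a = sum_i y_i / (F_X(x_i) (x_i - b_a)).  Partial fractions
   give al12 = al1 al2 (P_2 - P_1) / (b2 - b1), and all the identities follow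
   from the Riccati-type relation P_2' + P_2^2 - P_1' - P_1^2 = b2 - b1.
   To prove the latter, write f = (X - b_a) q_a: the cross terms y_i y_j cancel
   in P_a' + P_a^2, which becomes the sum of the residues of q_a / F^2 at the
   x_i.  As q_2 - q_1 = (b2 - b1) r with r monic of degree 2g - 1, the residues
   of (q_2 - q_1) / F^2 add up to b2 - b1. *)
Require Import Defs.
From HB Require Import structures.
From mathcomp Require Import all_boot all_order all_algebra.
From mathcomp Require Import complex ring.
From mathcomp Require Import all_classical all_reals all_analysis.
Import Order.TTheory GRing.Theory Num.Theory.
Import numFieldNormedType.Exports.

Set Implicit Arguments.
Unset Strict Implicit.

Local Open Scope classical_set_scope.
Local Open Scope ring_scope.

(** * Residues of [r / F ^+ 2] for a product [F] of distinct linear factors *)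

Lemma deriv_prod_XsubC (K : fieldType) (I : Type) (s : seq I) (P : pred I)
    (p : I -> K) (z : K) : (forall i, P i -> z - p i != 0) ->
  (\prod_(i <- s | P i) ('X - (p i)%:P))^`().[z] =
  (\prod_(i <- s | P i) ('X - (p i)%:P)).[z] * \sum_(i <- s | P i) (z - p i)^-1.
Proof.
move=> zP; elim: s => [|i s IH]; first by rewrite !big_nil derivC horner0 mulr0.
rewrite !big_cons; case: ifPn => // Pi.
rewrite derivM derivXsubC mul1r !hornerE IH mulrDr mulrAC divff ?zP // mul1r.
by rewrite mulrA.
Qed.

(** The product has degree at most [2n - 1], and that coefficient comes from the top ones of [A] and
    [B]. If [A] is shorter, both sides take the default value 0. *)
Lemma coefM_monic (K : fieldType) (n : nat) (A B : {poly K}) :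
  (0 < n)%N -> (size A <= n)%N -> B \is monic -> size B = n.+1 ->
  (A * B)`_(n.*2).-1 = A`_n.-1.
Proof.
move=> n_gt0 sA Bmon sB; have [sAn|sAn] := eqVneq (size A) n.
  have -> : n.*2.-1 = (size A + size B).-2 by rewrite sAn sB addnS addnn.
  by rewrite -mul_lead_coef (monicP Bmon) mulr1 lead_coefE sAn.
have ltAn : (size A < n)%N by rewrite ltn_neqAle sAn.
rewrite [A`__]nth_default; last by rewrite -ltnS prednK.
rewrite nth_default //; apply: leq_trans (size_polyMleq _ _) _.
by rewrite sB addnS /= -ltnS prednK ?double_gt0 // -addnn ltn_add2r.
Qed.

Section Nodes.
Context {K : fieldType} {n : nat}.
Variable p : 'I_n -> K.
Hypothesis p_inj : injective p.

Definition node_poly : {poly K} := \prod_(i < n) ('X - (p i)%:P).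
Local Notation F := node_poly.
Local Notation F_ i := (\prod_(j < n | j != i) ('X - (p j)%:P)).

Lemma node_polyD1 i : F = ('X - (p i)%:P) * F_ i.
Proof. by rewrite /node_poly (bigD1 i). Qed.

Lemma size_node_poly : size F = n.+1.
Proof. by rewrite size_prod_XsubC /index_enum -enumT size_enum_ord. Qed.

Lemma node_poly_monic : F \is monic.
Proof. exact: monic_prod_XsubC. Qed.

Lemma size_node_cofactor i : size (F_ i) = n.
Proof.
have := size_node_poly; rewrite (node_polyD1 i) mulrC size_Mmonic ?monicXsubC //.
  by rewrite size_XsubC addnS addn1 => -[].
by rewrite monic_neq0 // monic_prod_XsubC.
Qed.

Lemma horner_node_cofactor i j : j != i -> (F_ i).[p j] = 0.
Proof.
by move=> ji; rewrite (bigD1 j) //= hornerM hornerXsubC subrr mul0r.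
Qed.

Lemma deriv_node_poly i : F^`().[p i] = \prod_(j < n | j != i) (p i - p j).
Proof.
rewrite (node_polyD1 i) derivM derivXsubC mul1r !hornerE subrr mul0r addr0.
by rewrite horner_prod; apply: eq_bigr => j _; rewrite hornerXsubC.
Qed.

Lemma horner_node_cofactor_diag i : (F_ i).[p i] = F^`().[p i].
Proof.
by rewrite deriv_node_poly horner_prod; apply: eq_bigr => j _; rewrite hornerXsubC.
Qed.

Lemma deriv_node_poly_neq0 i : F^`().[p i] != 0.
Proof.
rewrite deriv_node_poly prodf_seq_neq0; apply/allP => j _; apply/implyP => ji.
by rewrite subr_eq0; apply: contraNneq ji => /p_inj->.
Qed.

(** Differentiating [('X - p i) * F_ i] twice leaves, at [p i], twice the derivative of the
    cofactor, which its logarithmic derivative expresses. *)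
Lemma deriv2_node_poly i :
  F^`()^`().[p i] =
  2 * F^`().[p i] * \sum_(j < n | j != i) (p i - p j)^-1.
Proof.
have pij j : j != i -> p i - p j != 0.
  by move=> ji; rewrite subr_eq0; apply: contraNneq ji => /p_inj->.
rewrite -horner_node_cofactor_diag -mulrA -deriv_prod_XsubC; last exact: pij.
rewrite (node_polyD1 i) derivM derivXsubC mul1r derivD derivM derivXsubC.
rewrite mul1r !hornerD hornerM hornerXsubC subrr mul0r addr0.
by rewrite -mulr2n mulr_natl.
Qed.

Lemma node_poly_dvd (A : {poly K}) : (forall i, A.[p i] = 0) -> F %| A.
Proof.
move=> A0; rewrite /node_poly -(big_map p predT (fun z => 'X - z%:P)).
apply: uniq_roots_dvdp.
  by apply/allP => _ /mapP[i _ ->]; apply/rootP.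
by rewrite uniq_rootsE map_inj_uniq // /index_enum -enumT enum_uniq.
Qed.

Definition interpolant (v : 'I_n -> K) : {poly K} :=
  \sum_(i < n) (v i / F^`().[p i]) *: F_ i.

Lemma size_interpolant v : (size (interpolant v) <= n)%N.
Proof.
apply: (leq_trans (size_sum _ _ _)); apply/bigmax_leqP => i _.
by rewrite (leq_trans (size_scale_leq _ _)) ?size_node_cofactor.
Qed.

Lemma horner_interpolant v i : (interpolant v).[p i] = v i.
Proof.
rewrite horner_sum (bigD1 i) //= hornerZ horner_node_cofactor_diag.
rewrite divfK ?deriv_node_poly_neq0 // big1 ?addr0 // => j ji.
by rewrite hornerZ horner_node_cofactor ?mulr0 // eq_sym.
Qed.

(** The difference vanishes at the nodes, so [F] divides it; its size is at most [n], below that of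
    [F], hence it is 0. *)
Lemma interpolant_horner (A : {poly K}) : (size A <= n)%N ->
  interpolant (fun i => A.[p i]) = A.
Proof.
move=> sA; apply/eqP; rewrite -subr_eq0; apply: contraTT isT => nz.
have /dvdp_leq : F %| interpolant (fun i => A.[p i]) - A.
  by apply: node_poly_dvd => i; rewrite hornerD hornerN horner_interpolant subrr.
move=> /(_ nz); rewrite size_node_poly ltnNge.
by rewrite (leq_trans (size_polyD _ _)) // size_polyN geq_max size_interpolant.
Qed.

(** Compare coefficients of degree [n - 1] in Lagrange's formula: every cofactor is monic of that
    degree. *)
Lemma sum_lagrange (A : {poly K}) : (0 < n)%N -> (size A <= n)%N ->
  \sum_(i < n) A.[p i] / F^`().[p i] = A`_n.-1.
Proof.
move=> n_gt0 sA; rewrite -[in RHS](interpolant_horner sA) coef_sum.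
apply: eq_bigr => i _; rewrite coefZ.
have /monicP := monic_prod_XsubC (index_enum 'I_n) (fun j => j != i) p.
by rewrite lead_coefE size_node_cofactor => ->; rewrite mulr1.
Qed.

(* Divide [r = H F' + A F] with [H] of degree [< n]: the i-th summand becomes
   [(H' + A)(p i) / F'(p i)], so [sum_lagrange] applies to [H' + A]. *)
Lemma sum_double_lagrange (r : {poly K}) : (0 < n)%N -> (size r <= n.*2)%N ->
  \sum_(i < n) (r^`().[p i] - 2 * r.[p i] * \sum_(j < n | j != i) (p i - p j)^-1)
    / F^`().[p i] ^+ 2 = r`_(n.*2).-1.
Proof.
move=> n_gt0 sr.
pose H := interpolant (fun i => r.[p i] / F^`().[p i]).
have sH : (size H <= n)%N by exact: size_interpolant.
have /dvdpP[A rE] : F %| r - H * F^`().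
  apply: node_poly_dvd => i; rewrite hornerD hornerN hornerM horner_interpolant.
  by rewrite divfK ?subrr ?deriv_node_poly_neq0.
have {}rE : r = H * F^`() + A * F by rewrite -rE addrC subrK.
have sF' : (size F^`() <= n)%N.
  by rewrite -ltnS -size_node_poly lt_size_deriv // monic_neq0 ?node_poly_monic.
have sHF : (size (H * F^`())%R <= n.*2.-1)%N.
  apply: (leq_trans (size_polyMleq _ _)).
  by rewrite -!subn1 leq_sub2r // -addnn leq_add.
have sA : (size A <= n)%N.
  have [->|A0] := eqVneq A 0; first by rewrite size_poly0.
  have : (size (A * F)%R <= n.*2)%N.
    have -> : A * F = r - H * F^`() by rewrite rE addrC addrA addNr add0r.
    rewrite (leq_trans (size_polyD _ _)) // size_polyN geq_max sr.
    exact: leq_trans sHF (leq_pred _).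
  by rewrite size_Mmonic ?node_poly_monic // size_node_poly addnS -addnn leq_add2r.
have AF : (A * F)`_(n.*2).-1 = A`_n.-1.
  by rewrite coefM_monic ?node_poly_monic ?size_node_poly.
transitivity (\sum_(i < n) (H^`() + A).[p i] / F^`().[p i]).
  apply: eq_bigr => i _.
  have F0 := deriv_node_poly_neq0 i.
  have Fi : F.[p i] = 0 by rewrite (node_polyD1 i) hornerM hornerXsubC subrr mul0r.
  rewrite rE !derivD !derivM !(hornerD, hornerM) Fi !mulr0 !addr0 deriv2_node_poly.
  by field.
have sH' : (size H^`() <= n.-1)%N.
  have [->|H0] := eqVneq H 0; first by rewrite deriv0 size_poly0.
  by rewrite -ltnS prednK // (leq_trans (lt_size_deriv H0)).
rewrite sum_lagrange //; last first.
  rewrite (leq_trans (size_polyD _ _)) // geq_max sA andbT.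
  exact: leq_trans sH' (leq_pred _).
(* Only [A] contributes: [H'] and [H F'] have sizes at most [n - 1] and [2n - 1], so their
   coefficients at these indices are 0. *)
by rewrite [in RHS]rE !coefD AF [H^`()`__]nth_default ?[(H * _)`__]nth_default.
Qed.

End Nodes.

(** * The Riccati-type relation *)

Section Riccati.
Context {K : fieldType} {n : nat}.
Variables (p y : 'I_n -> K) (f : {poly K}).
Hypothesis p_inj : injective p.
Hypothesis y2 : forall i, y i ^+ 2 = f.[p i].
Local Notation F' i := (node_poly p)^`().[p i].
Local Notation dp i := (2 * y i / F' i).

(** When the nodes move with velocities [dp i], this is the logarithmic derivative of a square root
    of the product of the [p i - c]; the root absorbs the 2 of [dp i]. *)
Definition log_deriv (c : K) : K := \sum_(i < n) y i / (F' i * (p i - c)).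

(* What the derivative of [log_deriv c] becomes when the nodes move with
   velocities [dp i], and [y i] with velocity [f'(p i) / F' i]. *)
Definition log_deriv_deriv (c : K) : K := \sum_(i < n)
  (f^`().[p i] / F' i / (F' i * (p i - c))
   - y i / (F' i * (p i - c))
     * (\sum_(j < n | j != i) (dp i - dp j) / (p i - p j) + dp i / (p i - c))).

(** The sum of the residues of [r / F ^+ 2] at the nodes, with [F] the node polynomial of [p]. *)
Definition double_lagrange (r : {poly K}) : K :=
  \sum_(i < n) (r^`().[p i] - 2 * r.[p i] * \sum_(j < n | j != i) (p i - p j)^-1)
    / F' i ^+ 2.

(* The terms [y i * y j] with [i != j] of the derivative and of the square
   cancel after symmetrisation in [i] and [j]. *)
Lemma riccati (c : K) (q : {poly K}) : f = ('X - c%:P) * q ->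
  (forall i, p i != c) ->
  log_deriv_deriv c + log_deriv c ^+ 2 = double_lagrange q.
Proof.
move=> fE pc.
pose a i := y i / (F' i * (p i - c)).
(* Chosen so that [2 * s i j] is [a i * dp j / (p i - p j)], while
   [s i j + s j i = - (a i * a j)]. *)
pose s i j := a i * a j * (p j - c) / (p i - p j).
have F0 i : F' i != 0 by exact: deriv_node_poly_neq0.
have pc0 i : p i - c != 0 by rewrite subr_eq0.
have pij i j : j != i -> p i - p j != 0.
  by move=> ji; rewrite subr_eq0; apply: contraNneq ji => /p_inj->.
have termE i : f^`().[p i] / F' i / (F' i * (p i - c))
   - y i / (F' i * (p i - c))
     * (\sum_(j < n | j != i) (dp i - dp j) / (p i - p j) + dp i / (p i - c))
  = (q^`().[p i] - 2 * q.[p i] * \sum_(j < n | j != i) (p i - p j)^-1) / F' i ^+ 2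
    - a i ^+ 2 + \sum_(j < n | j != i) 2 * s i j.
  have sumE : a i * (\sum_(j < n | j != i) (dp i - dp j) / (p i - p j)) =
     a i * dp i * (\sum_(j < n | j != i) (p i - p j)^-1)
     - \sum_(j < n | j != i) 2 * s i j.
    rewrite !mulr_sumr -sumrB; apply: eq_bigr => j ji; rewrite /s /a.
    by field; rewrite ?F0 ?pc0 ?pij.
  rewrite -/(a i) [a i * (_ + _)]mulrDr sumE.
  have fE' : f^`().[p i] = q.[p i] + (p i - c) * q^`().[p i].
    by rewrite fE derivM derivXsubC mul1r !(hornerXsubC, hornerD, hornerM).
  have yE : y i ^+ 2 = (p i - c) * q.[p i] by rewrite y2 fE !(hornerXsubC, hornerM).
  rewrite fE' /a; set t := \sum_(j < n | j != i) (2 * _).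
  set S := \sum_(j < n | j != i) (_ - _)^-1.
  (* Eliminating [q.[p i]] turns the goal into an identity of rational functions. *)
  have -> : q.[p i] = y i ^+ 2 / (p i - c) by rewrite yE mulrAC divff ?mul1r.
  by field; rewrite F0 pc0.
have sE : \sum_(i < n) \sum_(j < n | j != i) 2 * s i j =
    - \sum_(i < n) \sum_(j < n | j != i) a i * a j.
  have <- : \sum_(i < n) \sum_(j < n | j != i) (s i j + s j i) =
    - \sum_(i < n) \sum_(j < n | j != i) a i * a j.
    rewrite -sumrN; apply: eq_bigr => i _; rewrite -sumrN.
    apply: eq_bigr => j ji; rewrite /s.
    by field; rewrite !pij // eq_sym.
  (* Of the two copies of [s i j], the second becomes [s j i] by exchanging the summations. *)
  transitivity (\sum_(i < n) (\sum_(j < n | j != i) s i j + \sum_(j < n | j != i) s i j)).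
    apply: eq_bigr => i _; rewrite -big_split /=.
    by apply: eq_bigr => j _; rewrite mulr_natl mulr2n.
  under [RHS]eq_bigr do rewrite big_split /=.
  rewrite !big_split /=; congr (_ + _).
  rewrite (exchange_big_dep xpredT) //=.
  by apply: eq_bigr => j _; apply: eq_bigl => i; rewrite eq_sym.
rewrite /log_deriv_deriv (eq_bigr _ (fun i _ => termE i)) !big_split /= sE sumrN.
have -> : log_deriv c ^+ 2 =
    \sum_(i < n) a i ^+ 2 + \sum_(i < n) \sum_(j < n | j != i) a i * a j.
  rewrite expr2 big_distrlr /= -big_split /=; apply: eq_bigr => i _.
  by rewrite (bigD1 i).
by rewrite /double_lagrange; ring.
Qed.

(** The quotients of [f] by ['X - c2] and ['X - c1] are [('X - c1) * r] and [('X - c2) * r]. Each is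
    too large for [sum_double_lagrange], but their difference [(c2 - c1) *: r] has degree at most
    [2n - 1], with coefficient [c2 - c1] there. *)
Lemma riccatiB (c1 c2 : K) (r : {poly K}) : (0 < n)%N ->
  f = ('X - c1%:P) * ('X - c2%:P) * r -> r \is monic -> size r = n.*2 ->
  (forall i, p i != c1) -> (forall i, p i != c2) ->
  (log_deriv_deriv c2 + log_deriv c2 ^+ 2) - (log_deriv_deriv c1 + log_deriv c1 ^+ 2) =
  c2 - c1.
Proof.
move=> n_gt0 fE rmon sr pc1 pc2.
rewrite (@riccati c2 (('X - c1%:P) * r)) ?(@riccati c1 (('X - c2%:P) * r)) //;
  [|by rewrite fE mulrA|by rewrite fE mulrA [_ * ('X - c1%:P)]mulrC].
transitivity (double_lagrange ((c2 - c1) *: r)).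
  rewrite /double_lagrange -sumrB; apply: eq_bigr => i _.
  rewrite -mul_polyC !derivM !derivXsubC derivC !(mul0r, mul1r, add0r).
  rewrite !(hornerXsubC, hornerD, hornerM, hornerC).
  by have F0 := deriv_node_poly_neq0 p_inj i; field.
rewrite /double_lagrange sum_double_lagrange //; last first.
  by rewrite (leq_trans (size_scale_leq _ _)) ?sr.
rewrite coefZ; have := monicP rmon; rewrite lead_coefE sr => ->.
by rewrite mulr1.
Qed.

(** Termwise partial fractions in [p i]; this links the sum defining al12 to the logarithmic
    derivatives. *)
Lemma log_derivB (c1 c2 : K) : c2 - c1 != 0 ->
  (forall i, p i != c1) -> (forall i, p i != c2) ->
  \sum_(i < n) y i / ((c1 - p i) * (c2 - p i) * F' i) =
  (log_deriv c2 - log_deriv c1) / (c2 - c1).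
Proof.
move=> c12 pc1 pc2; rewrite -sumrB mulr_suml; apply: eq_bigr => i _.
have F0 := deriv_node_poly_neq0 p_inj i.
have n1 : p i - c1 != 0 by rewrite subr_eq0.
have n2 : p i - c2 != 0 by rewrite subr_eq0.
by field; rewrite F0 c12 n1 n2 -(opprB (p i) c1) -(opprB (p i) c2) !oppr_eq0 n1 n2.
Qed.

End Riccati.

(** * Derivatives in a fixed direction *)

Section Derivatives.
Context {K : numFieldType} {V : normedModType K}.
Implicit Types (u v : V) (f g : V -> K).

Lemma is_derive_mul u v f g (df dg : K) :
  is_derive u v f df -> is_derive u v g dg ->
  is_derive u v (fun w => f w * g w) (f u * dg + g u * df).
Proof. by move=> fd gd; exact: (is_deriveM fd gd). Qed.

Lemma is_derive_inv u v f (df : K) : f u != 0 ->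
  is_derive u v f df -> is_derive u v (fun w => (f w)^-1) (- df / f u ^+ 2).
Proof.
move=> fu0 [fd <-]; split; first exact: derivableV.
by rewrite deriveV // scaleNr mulNr mulrC.
Qed.

(** This form of the quotient rule isolates the logarithmic derivative of [g], as in the summands of
    [log_deriv_deriv]. *)
Lemma is_derive_div u v f g (df dg : K) : g u != 0 ->
  is_derive u v f df -> is_derive u v g dg ->
  is_derive u v (fun w => f w / g w) (df / g u - f u / g u * (dg / g u)).
Proof.
move=> gu0 fd gd; apply: is_derive_eq (is_derive_mul fd (is_derive_inv gu0 gd)) _.
by field.
Qed.

Lemma is_derive_sub u v f g (df dg : K) :
  is_derive u v f df -> is_derive u v g dg ->
  is_derive u v (fun w => f w - g w) (df - dg).
Proof. by move=> fd gd; exact: (is_deriveB fd gd). Qed.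

Lemma is_derive_subC u v f (df c : K) :
  is_derive u v f df -> is_derive u v (fun w => f w - c) df.
Proof.
move=> fd; apply: is_derive_eq (is_derive_sub fd (is_derive_cst c u v)) _.
exact: subr0.
Qed.

Lemma is_derive_bigsum n (f : 'I_n -> V -> K) (df : 'I_n -> K) u v :
  (forall i, is_derive u v (f i) (df i)) ->
  is_derive u v (fun w => \sum_(i < n) f i w) (\sum_(i < n) df i).
Proof.
by move=> fd; have := is_derive_sum fd; congr is_derive; apply/funext => w;
  rewrite fct_sumE.
Qed.

Lemma is_derive_prod (I : Type) (s : seq I) (P : pred I)
    (f : I -> V -> K) (df : I -> K) u v :
  (forall i, P i -> f i u != 0) -> (forall i, is_derive u v (f i) (df i)) ->
  is_derive u v (fun w => \prod_(i <- s | P i) f i w)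
    (\prod_(i <- s | P i) f i u * \sum_(i <- s | P i) df i / f i u).
Proof.
move=> f0 fd; elim: s => [|i s IH].
  rewrite !big_nil mulr0.
  by under eq_fun do rewrite big_nil; exact: is_derive_cst.
have -> : (fun w => \prod_(j <- i :: s | P j) f j w) =
    (fun w => (if P i then f i w else 1) * \prod_(j <- s | P j) f j w).
  by apply/funext => w; rewrite big_cons; case: ifP; rewrite ?mul1r.
rewrite !big_cons; case: ifPn => Pi; last first.
  by under eq_fun do rewrite mul1r.
apply: is_derive_eq (is_derive_mul (fd i) IH) _.
by have := f0 i Pi => ?; field.
Qed.

Lemma near_open (U : set V) u (Q : V -> Prop) : open U -> U u ->
  (forall w, U w -> Q w) -> \near u, Q u.
Proof. by move=> U_open Uu UQ; apply: filterS (open_nbhs_nbhs (conj U_open Uu)). Qed.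

Lemma open_is_derive (U : set V) u v f g df : open U -> U u ->
  (forall w, U w -> f w = g w) -> is_derive u v f df -> is_derive u v g df.
Proof.
by move=> U_open Uu fg; apply: near_eq_is_derive; exact: (near_open U_open Uu fg).
Qed.

(** The first derivative is [g] on all of [U], hence near [u], so it can be replaced by [g] before
    differentiating again. *)
Lemma open_derive2 (U : set V) u v f g dg : open U -> U u ->
  (forall w, U w -> is_derive w v f (g w)) -> is_derive u v g dg ->
  'D_v (fun w => 'D_v f w) u = dg.
Proof.
move=> U_open Uu fg gd.
suff : is_derive u v (fun w => 'D_v f w) dg by case.
by apply: (open_is_derive U_open Uu _ gd) => w /fg [].
Qed.

(** Reduces a directional derivative to one variable, so that an equality of functions is needed
    only on the line through [u] directed by [v]. *)
Lemma is_derive_line u v f df :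
  is_derive u v f df <-> is_derive (0 : K) 1 (fun h : K => f (h *: v + u)) df.
Proof.
have E : 'D_1 (fun h : K => f (h *: v + u)) 0 = 'D_v f u.
  apply: (congr1 (fun F : K -> K => lim (F @ (0 : K)^'))); apply/funext => h /=.
  by rewrite addr0 scale0r add0r [_ *: 1]mulr1.
by split=> -[fd <-]; split; rewrite ?E //; exact/(derivable1P f u v).
Qed.

(** Derivability along [v] gives continuity along that line only, hence the restriction of the
    conclusion to the line. *)
Lemma derivable_near_neq0 u v f : derivable f u v -> f u != 0 ->
  \forall h \near (0 : K), f (h *: v + u) != 0.
Proof.
move=> /derivable1P /derivable1_diffP /differentiable_continuous fc fu0.
by apply: (cvgr_neq0 _ fc); rewrite scale0r add0r.
Qed.

Lemma open_line (U : set V) u v : open U -> U u ->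
  \forall h \near (0 : K), U (h *: v + u).
Proof.
move=> U_open Uu.
have : {for 0 : K, continuous (fun h : K => h *: v + u)}.
  apply: continuousD; first exact: scalel_continuous.
  exact: cst_continuous.
by rewrite /prop_for /continuous_at scale0r add0r; apply; apply: open_nbhs_nbhs; split.
Qed.

(** * Second-order identities from the Riccati-type relation, with [W] in the role of al12 *)

Section SecondOrder.
Variables (U : set V) (v : V) (d : K) (A1 A2 P1 P2 Q1 Q2 : V -> K).
Hypothesis U_open : open U.
Hypothesis d0 : d != 0.
Hypothesis A1_neq0 : forall u, U u -> A1 u != 0.
Hypothesis A1D : forall u, U u -> is_derive u v A1 (A1 u * P1 u).
Hypothesis A2D : forall u, U u -> is_derive u v A2 (A2 u * P2 u).
Hypothesis P1D : forall u, U u -> is_derive u v P1 (Q1 u).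
Hypothesis P2D : forall u, U u -> is_derive u v P2 (Q2 u).
Hypothesis PQ : forall u, U u -> (Q2 u + P2 u ^+ 2) - (Q1 u + P1 u ^+ 2) = d.
Variable W : V -> K.
Hypothesis WE : forall u, U u -> W u = A1 u * A2 u * (P2 u - P1 u) / d.

Let Q2E u : U u -> Q2 u = d + Q1 u + P1 u ^+ 2 - P2 u ^+ 2.
Proof. by move=> Uu; rewrite -(PQ Uu); ring. Qed.

(** The product rule gives [A1 A2 ((P1 + P2) (P2 - P1) + Q2 - Q1) / d], whose bracket is [d] by
    [PQ]. *)
Lemma is_derive_along_W u : U u -> is_derive u v W (A1 u * A2 u).
Proof.
move=> Uu.
have := is_derive_div d0 (is_derive_mul (is_derive_mul (A1D Uu) (A2D Uu))
  (is_derive_sub (P2D Uu) (P1D Uu))) (is_derive_cst d u v).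
move=> /(open_is_derive U_open Uu (fun w Uw => esym (WE Uw))) dW.
by apply: is_derive_eq dW _; rewrite (Q2E Uu) /cst; field.
Qed.

Lemma derive2_W u : U u ->
  'D_v (fun w => 'D_v W w) u = (P2 u + P1 u) * (A1 u * A2 u).
Proof.
move=> Uu; apply: (open_derive2 U_open Uu is_derive_along_W).
by apply: is_derive_eq (is_derive_mul (A1D Uu) (A2D Uu)) _; ring.
Qed.

(** The ratio has logarithmic derivative [P2 - P1], so its second derivative carries the factor
    [(P2 - P1)^2 + Q2 - Q1]; [PQ] removes the [Q]s and the squares of [P2]. *)
Lemma derive2_ratio u : U u ->
  'D_v (fun w => 'D_v (fun z => A2 z / A1 z) w) u =
  (2 * P1 u * (P1 u - P2 u) + d) * (A2 u / A1 u).
Proof.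
move=> Uu.
apply: (open_derive2 (g := fun w => A2 w / A1 w * (P2 w - P1 w)) U_open Uu).
  move=> w Uw; have A10 := A1_neq0 Uw.
  by apply: is_derive_eq (is_derive_div A10 (A2D Uw) (A1D Uw)) _; field.
have A10 := A1_neq0 Uu.
apply: is_derive_eq (is_derive_mul (is_derive_div A10 (A2D Uu) (A1D Uu))
  (is_derive_sub (P2D Uu) (P1D Uu))) _.
by rewrite (Q2E Uu); field.
Qed.

Lemma derive2_inv_W u : U u -> W u != 0 ->
  'D_v (fun w => 'D_v (fun z => (W z)^-1) w) u =
  - (P2 u + P1 u) * (A1 u * A2 u) / W u ^+ 2
  + 2 * (A1 u * A2 u) ^+ 2 / W u ^+ 3.
Proof.
move=> Uu Wu0.
(* The first derivative of [1 / W] wherever [W] does not vanish, since [W' = A1 A2]. *)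
pose g w := - (A1 w * A2 w / W w ^+ 2).
have W2D w : U w -> is_derive w v (fun z => W z ^+ 2) (2 * W w * (A1 w * A2 w)).
  move=> Uw; under eq_fun do rewrite expr2.
  have WD := is_derive_along_W Uw.
  by apply: is_derive_eq (is_derive_mul WD WD) _; ring.
have gd : is_derive u v g (- (P2 u + P1 u) * (A1 u * A2 u) / W u ^+ 2
  + 2 * (A1 u * A2 u) ^+ 2 / W u ^+ 3).
  have W20 : W u ^+ 2 != 0 by rewrite expf_neq0.
  apply: is_derive_eq (is_deriveN (is_derive_div W20
    (is_derive_mul (A1D Uu) (A2D Uu)) (W2D u Uu))) _.
  by field.
suff : is_derive u v (fun w => 'D_v (fun z => (W z)^-1) w)
  (- (P2 u + P1 u) * (A1 u * A2 u) / W u ^+ 2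
  + 2 * (A1 u * A2 u) ^+ 2 / W u ^+ 3) by case.
(* [W] is only known to be derivable along [v], so the quotient rule holds near
   [u] on the line directed by [v]. *)
apply/is_derive_line; move/is_derive_line: gd; apply: near_eq_is_derive.
have [Wu _] := is_derive_along_W Uu.
near=> h.
have Uh : U (h *: v + u) by near: h; exact: open_line.
have Wh : W (h *: v + u) != 0 by near: h; exact: derivable_near_neq0.
have [_ ->] := is_derive_inv Wh (is_derive_along_W Uh).
by rewrite mulNr.
Unshelve. all: by end_near. Qed.

End SecondOrder.
End Derivatives.

(** * Derivatives of expressions in nodes that depend on a point *)

Section MovingNodes.
Context {K : numFieldType} {V : normedModType K} {n : nat}.
Variables (x y : 'I_n -> V -> K) (u v : V) (f : {poly K}).
Local Notation F' i := (node_poly (x^~ u))^`().[x i u].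
Hypothesis x_inj : injective (x^~ u).
Hypothesis xD : forall i, is_derive u v (x i) (2 * y i u / F' i).

(** Both the polynomial and the evaluation point move; writing the value as the product of the
    [x i - x j] reduces this to logarithmic differentiation. *)
Lemma is_derive_deriv_node_poly i :
  is_derive u v (fun w => (node_poly (x^~ w))^`().[x i w])
    (F' i * \sum_(j < n | j != i)
       (2 * y i u / F' i - 2 * y j u / F' j) / (x i u - x j u)).
Proof.
under eq_fun do rewrite (deriv_node_poly (x^~ _)).
rewrite [X in X * _](deriv_node_poly (x^~ u)).
apply: (is_derive_prod _ _ (fun j => is_derive_sub (xD i) (xD j))) => j ji.
by rewrite subr_eq0; apply: contraNneq ji => /x_inj->.
Qed.

Lemma is_derive_log_deriv c :
  (forall i, is_derive u v (y i) (f^`().[x i u] / F' i)) ->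
  (forall i, x i u != c) ->
  is_derive u v (fun w => log_deriv (x^~ w) (y^~ w) c)
    (log_deriv_deriv (x^~ u) (y^~ u) f c).
Proof.
move=> yD xc; apply: is_derive_bigsum => i.
have F0 : F' i != 0 by exact: deriv_node_poly_neq0.
have xc0 : x i u - c != 0 by rewrite subr_eq0.
have den0 : F' i * (x i u - c) != 0 by rewrite mulf_neq0.
have D := is_derive_mul (is_derive_deriv_node_poly i) (is_derive_subC c (xD i)).
have /(_ den0) {}D := is_derive_div _ (yD i) D.
apply: is_derive_eq D _.
by congr (_ - _ * _); field; rewrite F0 xc0.
Qed.

(** Differentiating [A ^+ 2] in two ways gives [2 A A' = 2 A^2 log_deriv], and [2 A] cancels because
    no factor [x i u - c] vanishes. The choice of branch does not matter. *)
Lemma is_derive_sqrt_prod (U : set V) (A : V -> K) c : open U -> U u ->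
  (forall w, U w -> A w ^+ 2 = \prod_(i < n) (x i w - c)) ->
  (forall i, x i u != c) -> derivable A u v ->
  A u != 0 /\ is_derive u v A (A u * log_deriv (x^~ u) (y^~ u) c).
Proof.
move=> U_open Uu A2 xc Ad.
have xc0 i : x i u - c != 0 by rewrite subr_eq0.
have A0 : A u != 0.
  have : A u ^+ 2 != 0 by rewrite A2 //; apply/prodf_neq0 => i _; exact: xc0.
  by rewrite expf_eq0.
split=> //; apply: DeriveDef => //.
have AD : is_derive u v A ('D_v A u) by split.
have := is_derive_mul AD AD.
move=> /(open_is_derive U_open Uu (fun w Uw => etrans (esym (expr2 _)) (A2 w Uw))) [_].
have [_ ->] := is_derive_prod (P := xpredT) (f := fun i w => x i w - c)
  (index_enum 'I_n) (fun i _ => xc0 i) (fun i => is_derive_subC c (xD i)).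
have -> : \sum_(i < n) 2 * y i u / F' i / (x i u - c) =
    2 * log_deriv (x^~ u) (y^~ u) c.
  rewrite mulr_sumr; apply: eq_bigr => i _.
  by field; rewrite xc0 deriv_node_poly_neq0.
rewrite -A2 // => E; apply: (mulfI A0).
have K2 : (2 : K) != 0 by rewrite pnatr_eq0.
apply: (mulfI K2).
by rewrite [LHS]mulr_natl mulr2n -E; ring.
Qed.

End MovingNodes.

(** * Specialisation to the al functions of the hyperelliptic curve *)

Theorem theorem5p6 (R : realType) (g : nat) (g_ge1 : (1 <= g)%N)
    (b : 'I_(2 * g).+1 -> Cplx R) (b_inj : injective b)
    (b1 b2 : Cplx R) (b1E : b1 = b (inord 0)) (b2E : b2 = b (inord 1))
    (U : set 'rV[Cplx R]_g) (U_open : open U)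
    (x y : 'I_g -> 'rV[Cplx R]_g -> Cplx R)
    (xy_curve : forall u, U u -> forall i, on_curve b (x i u) (y i u))
    (x_holo : forall i, holomorphic_on U (x i))
    (y_holo : forall i, holomorphic_on U (y i))
    (x_inj : forall u, U u -> injective (fun i => x i u))
    (x_neq_b12 : forall u, U u -> forall i, x i u != b1 /\ x i u != b2)
    (u_abel : forall u, U u ->
       abel_value b (fun i => x i u) (fun i => y i u) u)
    (x_partial : forall u, U u -> forall i r,
       partial r (x i) u =
         2 * y i u * chi (fun k => x k u) i r /
         (Fpoly (fun k => x k u))^`().[x i u])
    (y_partial : forall u, U u -> forall i r,
       partial r (y i) u =
         (fpoly b)^`().[x i u] * chi (fun k => x k u) i r /
         (Fpoly (fun k => x k u))^`().[x i u])
    (al1 al2 : 'rV[Cplx R]_g -> Cplx R)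
    (al1P : al_branch U x b1 al1) (al2P : al_branch U x b2 al2) :
  let al12 := al_pair x y b1 b2 al1 al2 in
  let dphi1 := dlog al1 in
  let dphi2 := dlog al2 in
  let D12 := D_circ b1 b2 al1 al2 in
  let a12 := a_circ b1 b2 al1 al2 in
  forall u : 'rV[Cplx R]_g, U u ->
    [/\ partial_last (partial_last al12) u =
          (dphi2 u + dphi1 u) * (al1 u * al2 u),
        dphi2 u - dphi1 u != 0 ->
          partial_last (partial_last al12) u =
            (b2 - b1) * ((dphi2 u + dphi1 u) / (dphi2 u - dphi1 u)) * al12 u /\
          partial_last (partial_last al12) u = D12 u * al12 u,
        partial_last (partial_last (fun v => al2 v / al1 v)) u -
          (2 * dphi1 u * (dphi1 u - dphi2 u) + (b2 - b1)) * (al2 u / al1 u) = 0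
      & dphi2 u - dphi1 u != 0 -> al12 u != 0 ->
          partial_last (partial_last (fun v => (al12 v)^-1)) u +
            (D12 u - 2 * a12 u ^+ 2) * (al12 u)^-1 = 0].
Proof.
have Ng : (g.-1 < g)%N by rewrite prednK.
pose v : 'rV[Cplx R]_g := \row_(j < g) (j.+1 == g)%:R.
pose r0 := Ordinal Ng.
have vE : v = delta_mx 0 r0.
  apply/rowP => j; rewrite !mxE eqxx /=; congr (_%:R).
  by rewrite -(inj_eq val_inj) /= -[in RHS]eqSS prednK.
(* Since [g >= 1], the index 1 is in range and [inord 1] is not the default index 0. *)
have i10 : inord 1 != inord 0 :> 'I_(2 * g).+1.
  by rewrite -(inj_eq val_inj) /= !inordK // ltnS muln_gt0.
have b12 : b2 - b1 != 0 by rewrite subr_eq0 b1E b2E (inj_eq b_inj).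
(* The quotient of [Fpoly p] by ['X - p i] is the cofactor, monic of degree [g - 1]. *)
have chi1 (p : 'I_g -> Cplx R) i : chi p i g.-1 = 1.
  rewrite /chi /Fpoly -/(node_poly p) (node_polyD1 p i).
  rewrite mulKp ?polyXsubC_eq0 //.
  have /monicP := monic_prod_XsubC (index_enum 'I_g) (fun j => j != i) p.
  by rewrite lead_coefE size_node_cofactor.
have [r [fE rmon sr]] : exists r : {poly Cplx R},
    [/\ fpoly b = ('X - b1%:P) * ('X - b2%:P) * r, r \is monic & size r = g.*2].
  exists (\prod_(i < (2 * g).+1 | (i != inord 0) && (i != inord 1)) ('X - (b i)%:P)).
  have fE : fpoly b = ('X - b1%:P) * ('X - b2%:P) *
      \prod_(i < (2 * g).+1 | (i != inord 0) && (i != inord 1)) ('X - (b i)%:P).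
    by rewrite /fpoly (bigD1 (inord 0)) // (bigD1 (inord 1)) //= mulrA b1E b2E.
  have rmon : \prod_(i < (2 * g).+1 | (i != inord 0) && (i != inord 1))
      ('X - (b i)%:P) \is monic by exact: monic_prod_XsubC.
  split=> //.
  (* [fpoly b] is the node polynomial of the branch points, of degree [2g + 1]; removing two linear
     factors leaves degree [2g - 1]. *)
  have := size_node_poly b; rewrite /node_poly -/(fpoly b) fE.
  rewrite !size_Mmonic ?mulf_neq0 ?polyXsubC_eq0 ?monicXsubC //.
  by rewrite !size_XsubC -mul2n /= => -[].
pose X u : 'I_g -> Cplx R := x^~ u.
pose Y u : 'I_g -> Cplx R := y^~ u.
have xD u : U u -> forall i,
    is_derive u v (x i) (2 * y i u / (node_poly (X u))^`().[x i u]).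
  move=> Uu i; split; first exact/diff_derivable/x_holo.
  by have := x_partial _ Uu i r0; rewrite /partial -vE chi1 mulr1.
have yD u : U u -> forall i,
    is_derive u v (y i) ((fpoly b)^`().[x i u] / (node_poly (X u))^`().[x i u]).
  move=> Uu i; split; first exact/diff_derivable/y_holo.
  by have := y_partial _ Uu i r0; rewrite /partial -vE chi1 mulr1.
have xb1 u : U u -> forall i, x i u != b1 by move=> Uu i; case: (x_neq_b12 _ Uu i).
have xb2 u : U u -> forall i, x i u != b2 by move=> Uu i; case: (x_neq_b12 _ Uu i).
have A1d u : U u -> derivable al1 u v by move=> Uu; exact/diff_derivable/al1P.1.
have A2d u : U u -> derivable al2 u v by move=> Uu; exact/diff_derivable/al2P.1.
have A1P u (Uu : U u) := is_derive_sqrt_prod (x_inj _ Uu) (xD _ Uu)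
  U_open Uu al1P.2 (xb1 _ Uu) (A1d _ Uu).
have A2P u (Uu : U u) := is_derive_sqrt_prod (x_inj _ Uu) (xD _ Uu)
  U_open Uu al2P.2 (xb2 _ Uu) (A2d _ Uu).
pose P1 u := log_deriv (X u) (Y u) b1.
pose P2 u := log_deriv (X u) (Y u) b2.
have dl1 u : U u -> dlog al1 u = P1 u.
  by move=> /A1P[A0 [_ E]]; rewrite /dlog /partial_last -/v E mulrAC divff ?mul1r.
have dl2 u : U u -> dlog al2 u = P2 u.
  by move=> /A2P[A0 [_ E]]; rewrite /dlog /partial_last -/v E mulrAC divff ?mul1r.
have PQ u : U u -> (log_deriv_deriv (X u) (Y u) (fpoly b) b2 + P2 u ^+ 2) -
    (log_deriv_deriv (X u) (Y u) (fpoly b) b1 + P1 u ^+ 2) = b2 - b1.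
  move=> Uu; apply: riccatiB fE rmon sr _ _ => //.
  - exact: x_inj.
  - by move=> i; exact: xy_curve.
  - exact: xb1.
  - exact: xb2.
have WE u : U u -> al_pair x y b1 b2 al1 al2 u =
    al1 u * al2 u * (P2 u - P1 u) / (b2 - b1).
  move=> Uu; rewrite /al_pair -[RHS]mulrA; congr (_ * _).
  exact: (log_derivB (y^~ u) (x_inj _ Uu) b12 (xb1 _ Uu) (xb2 _ Uu)).
have P1D u (Uu : U u) := is_derive_log_deriv (x_inj _ Uu) (xD _ Uu) (yD _ Uu) (xb1 _ Uu).
have P2D u (Uu : U u) := is_derive_log_deriv (x_inj _ Uu) (xD _ Uu) (yD _ Uu) (xb2 _ Uu).
have al1_neq0 u (Uu : U u) := (A1P u Uu).1.
have A1D u (Uu : U u) := (A1P u Uu).2.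
have A2D u (Uu : U u) := (A2P u Uu).2.
move=> al12 dphi1 dphi2 D12 a12 u Uu.
have E1 : partial_last (partial_last al12) u = (P2 u + P1 u) * (al1 u * al2 u).
  exact: (derive2_W U_open b12 A1D A2D P1D P2D PQ WE Uu).
have W1 := WE _ Uu; rewrite -/al12 in W1.
have [n1 _] := A1P _ Uu; have [n2 _] := A2P _ Uu.
rewrite /D12 /D_circ /a12 /a_circ /dphi1 /dphi2 !dl1 // !dl2 //; split => //.
(* By [W1], multiplying [al12 u] by [(b2 - b1) / (P2 u - P1 u)] gives [al1 u * al2 u]. *)
- by move=> P0; rewrite E1 W1; split; field; rewrite P0 b12.
- rewrite /partial_last -/v.
  by rewrite (derive2_ratio U_open al1_neq0 A1D A2D P1D P2D PQ Uu) subrr.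
- move=> P0 W0; rewrite /partial_last -/v.
  (* Here [al1 al2 / al12] is [a12], and [D12 = a12 (P1 + P2)], so the two terms of the second
     derivative are [- D12 / al12] and [2 a12^2 / al12]. *)
  rewrite (derive2_inv_W U_open b12 A1D A2D P1D P2D PQ WE Uu W0) -/al12 W1.
  by rewrite -/(P1 u) -/(P2 u); field; rewrite P0 b12 n1 n2.
Qed.
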